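(* Let $h$ be any function with $h(m)\to\infty$ as $m\to\infty$. Let $(\mathcal D_\ell)_{\ell\ge 1}$ be a sequence of feasible degree sequences. If $n_0(\mathcal D_\ell)=0$ for all $\ell$ and $G(\mathcal D_\ell)$ has a giant component, then with high probability the mixing time of every component of $G(\mathcal D_\ell)$ is $O(n^2h(m)\log n)$, where $n=n(\mathcal D_\ell)$ and $m=m(\mathcal D_\ell)$.
   Context: A sequence $\mathcal D=(d_1,\dots,d_n)$ with $d_1\le\dots\le d_n$ is a feasible degree sequence if there is a simple graph on $[n]=\{1,\dots,n\}$ in which vertex $i$ has degree $d_i$ for every $i$. $G(\mathcal D)$ is a uniformly random element of the set of simple graphs on $[n]$ with degree sequence $\mathcal D$. Write $n(\mathcal D)=n$, $m(\mathcal D)=\frac12\sum_i d_i$, $n_d(\mathcal D)=|\{i: d_i=d\}|$. For a sequence $(\mathcal D_\ell)_{\ell\ge1}$ it is always assumed that $n(\mathcal D_\ell)\to\infty$. The sequence has a giant component (also phrased ''$G(\mathcal D_\ell)$ has a giant component'') if there is $\epsilon>0$ such that the probability that $G(\mathcal D_\ell)$ has a component with at least $\epsilon n(\mathcal D_\ell)$ vertices tends to $1$ as $\ell\to\infty$. ''With high probability'' (whp) means with probability tending to $1$ as $\ell\to\infty$; ''whp $X_\ell=O(Y_\ell)$'' means that for some constant $C$ (not depending on $\ell$), $X_\ell\le CY_\ell$ holds with probability tending to $1$. The lazy random walk on a connected graph $H=(V,E)$, when at $u$, stays at $u$ with probability $\frac12$ and moves to each neighbour of $u$ with probability $\frac1{2\deg(u)}$.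 Its stationary distribution is $\pi(u)=\frac{\deg(u)}{2|E|}$. With $\mu^{t,i}$ the distribution after $t$ steps started from $i$ and $d_T(P,P')=\max_A|P(A)-P'(A)|$ the total variation distance, the mixing time of $H$ is $\tau_{\mathrm{mix}}(H)=\sup_{i\in V}\min\{t: d_T(\mu^{t,i},\pi)<\frac1e\}$. *)

(* Defs.v *)
From HB Require Import structures.
From mathcomp Require Import all_boot all_order all_algebra.
From mathcomp Require Import all_classical all_reals all_analysis.

Set Implicit Arguments.
Unset Strict Implicit.
Unset Printing Implicit Defensive.

Import Order.TTheory GRing.Theory Num.Theory.
Import numFieldNormedType.Exports.

Local Open Scope ring_scope.

Section SimpleGraph.
Variable V : finType.

Record sgraph := SGraph {
  edges : {set {set V}};
  edges_card2 : [forall e in edges, #|e| == 2%N] }.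

HB.instance Definition _ := [isSub for edges].
HB.instance Definition _ := [Finite of sgraph by <:].

End SimpleGraph.

Section Graphs.
Variables (V : finType) (G : sgraph V).

(* Irreflexive, because [set u; u] has cardinality 1. *)
Definition adj : rel V := fun u v => [set u; v]%SET \in edges G.

Definition deg (u : V) : nat := #|[set v | adj u v]%SET|.

Definition components : {set {set V}} :=
  equivalence_partition (connect adj) [set: V]%SET.

Definition induced_edges (C : {set V}) : {set {set {x : V | x \in C}}} :=
  [set e : {set {x : V | x \in C}} | (val @: e)%SET \in edges G]%SET.

Lemma induced_edges_card2 (C : {set V}) :
  [forall e in induced_edges C, #|e| == 2%N].
Proof.
apply/forall_inP => e; rewrite inE => eG.
have /forall_inP/(_ _ eG) := edges_card2 G.
by rewrite card_imset //; exact: val_inj.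
Qed.

Definition induced_subgraph (C : {set V}) : sgraph {x : V | x \in C} :=
  SGraph (induced_edges_card2 C).

End Graphs.

Section LazyWalk.
Variables (R : realType) (V : finType) (H : sgraph V).

Definition lazy_step (u v : V) : R :=
  if v == u then 2^-1
  else if adj H u v then (2 * (deg H u)%:R)^-1 else 0.

Fixpoint walk_dist (i : V) (t : nat) : V -> R :=
  if t is t'.+1 then fun v => \sum_(u : V) walk_dist i t' u * lazy_step u v
  else fun v => (v == i)%:R.

Definition stationary (u : V) : R := (deg H u)%:R / (2 * #|edges H|%:R).

Definition dTV (P Q : V -> R) : R :=
  \big[Num.max/0]_(A : {set V}) `|\sum_(x in A) P x - \sum_(x in A) Q x|.

(* Extended-real valued: the minimum over an empty set of times is +oo. *)
Definition mixing_time : \bar R :=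
  ereal_sup [set ereal_inf [set (t%:R)%:E | t in
    [set t : nat | dTV (walk_dist i t) stationary < (expR 1)^-1]]
  | i in [set: V]]%classic.

End LazyWalk.

Section DegreeSequences.
Variable D : seq nat.

Definition num_edges : nat := (sumn D)./2.

(* The vertex i of [n] is the ordinal i - 1. *)
Definition realizations : {set sgraph 'I_(size D)} :=
  [set G : sgraph 'I_(size D) |
    [forall i : 'I_(size D), deg G i == nth 0%N D i]]%SET.

Definition feasible : Prop :=
  sorted leq D /\ exists G : sgraph 'I_(size D), G \in realizations.

Definition prob (R : realType) (A : pred (sgraph 'I_(size D))) : R :=
  #|[set G in realizations | A G]%SET|%:R / #|realizations|%:R.

End DegreeSequences.

Definition whp (R : realType) (D : nat -> seq nat)
    (A : forall l, pred (sgraph 'I_(size (D l)))) : Prop :=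
  (prob R (A l) @[l --> \oo] --> (1 : R))%classic.
Arguments whp : clear implicits.

Definition has_giant_component (R : realType) (D : nat -> seq nat) : Prop :=
  exists2 eps : R, 0 < eps &
    whp R D (fun l G =>
      [exists C in components G, eps * (size (D l))%:R <= #|C|%:R]).

(* Main.v *)
(* Let s = 2m be the sum of the degrees, and call a vertex light if its degree is
   less than s / (8 n), so that light vertices account for at most s / 8 of the
   darts.  If the ball of radius k + 2 around v is light and does not exhaust its
   component, an edge leaving the ball of radius k can be switched with any of the
   at least 3 s / 4 darts between heavy vertices, and each switched graph is
   obtained at most s / 8 times: passing from radius k to k + 2 divides the number
   of such graphs by 6.  Hence, outside an event of probability at most 1 / n,
   every vertex has a heavy vertex within distance r = O(log n), or lies in a
   component of radius at most r.  Disjoint neighbourhoods of heavy vertices along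
   a geodesic then bound the diameter L by (8 n^2 / s + 1) (2 r + 3).

   A reversible lazy walk on a connected graph with degree sum M and diameter L
   mixes in time O(M L): the chi-square distance b_t to stationarity satisfies
   b_t - b_{t+1} >= b_t^2 / (4 M L), and as M <= s this is O(n^2 log n). *)

Require Import Defs.
From mathcomp Require Import all_boot all_order all_algebra.
From mathcomp Require Import all_classical all_reals all_analysis.
From mathcomp Require Import zify ring lra.

Set Implicit Arguments.
Unset Strict Implicit.
Unset Printing Implicit Defensive.

Import Order.TTheory GRing.Theory Num.Theory.
Import numFieldNormedType.Exports.
Local Open Scope ring_scope.

(** * Balls of the graph metric, and the diameter of a component *)

Section Balls.
Variables (V : finType) (G : sgraph V).

Lemma adj_sym (u v : V) : adj G u v = adj G v u.
Proof. by rewrite /adj finset.setUC. Qed.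

Lemma adj_irr (u : V) : adj G u u = false.
Proof.
apply/negP => uuG; have /forall_inP/(_ _ uuG) := edges_card2 G.
by rewrite finset.setUid cards1.
Qed.

Lemma adj_neq (u v : V) : adj G u v -> u != v.
Proof. by apply: contraTneq => ->; rewrite adj_irr. Qed.

Lemma connect_adj_sym : connect_sym (adj G).
Proof. by apply: sym_connect_sym => u v; rewrite adj_sym. Qed.

Lemma in_components (C : {set V}) (x y : V) :
  C \in components G -> x \in C -> (y \in C) = connect (adj G) x y.
Proof.
case/imsetP => z _ -> /[!inE] /= zx.
by rewrite (same_connect connect_adj_sym zx).
Qed.

Fixpoint gball (k : nat) (x : V) : {set V} :=
  if k is k'.+1 then
    gball k' x :|: [set z | [exists y in gball k' x, adj G y z]]%SET
  else [set x]%SET.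

Lemma gballSP (k : nat) (x z : V) :
  reflect (z \in gball k x \/ exists2 y, y \in gball k x & adj G y z)
          (z \in gball k.+1 x).
Proof.
rewrite /= !inE; apply: (iffP orP) => -[zB|]; try by left.
  by case/exists_inP => y yB yz; right; exists y.
by case=> y yB yz; right; apply/exists_inP; exists y.
Qed.

Lemma gball_center (k : nat) (x : V) : x \in gball k x.
Proof. by elim: k => [|k IH]; rewrite !inE ?IH. Qed.

Lemma gball_step (k : nat) (x y z : V) :
  y \in gball k x -> adj G y z -> z \in gball k.+1 x.
Proof. by move=> yB yz; apply/gballSP; right; exists y. Qed.

Lemma gball_add (k l : nat) (x y z : V) :
  y \in gball k x -> z \in gball l y -> z \in gball (k + l) x.
Proof.
move=> yB; elim: l z => [|l IH] z; first by rewrite addn0 inE => /eqP ->.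
rewrite addnS => /gballSP[/IH zB|[w /IH wB wz]]; apply/gballSP; first by left.
by right; exists w.
Qed.

Lemma gball_mono (k l : nat) (x y : V) :
  (k <= l)%N -> y \in gball k x -> y \in gball l x.
Proof. by move=> kl yB; rewrite -(subnKC kl) (gball_add yB) ?gball_center. Qed.

Lemma gball_adj (x y : V) : adj G x y -> y \in gball 1 x.
Proof. by move=> xy; apply: (@gball_step 0 x x); rewrite ?inE. Qed.

Lemma gball_sym (k : nat) (x y : V) : y \in gball k x -> x \in gball k y.
Proof.
elim: k y => [|k IH] y; first by rewrite !inE eq_sym.
case/gballSP => [/IH|[w /IH wB wy]]; first by apply: gball_mono.
by rewrite -add1n; apply: gball_add wB; rewrite gball_adj // adj_sym.
Qed.

Lemma gball_connect (k : nat) (x y : V) :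
  y \in gball k x -> connect (adj G) x y.
Proof.
elim: k y => [|k IH] y; first by rewrite inE => /eqP ->.
by case/gballSP => [/IH//|[w /IH xw wy]]; apply: connect_trans (connect1 wy).
Qed.

Lemma gball_path (k : nat) (x y : V) : y \in gball k x ->
  exists p, [/\ path (adj G) x p, last x p = y, uniq (x :: p) & (size p <= k)%N].
Proof.
move=> yB; suff [p [xp lp sp]] : exists p,
    [/\ path (adj G) x p, last x p = y & (size p <= k)%N].
  case/shortenP: xp lp => p' xp' up' pp' lp; exists p'; split => //.
  by apply: leq_trans sp; apply: uniq_leq_size => //; case/andP: up'.
elim: k y yB => [|k IH] y; first by rewrite inE => /eqP ->; exists [::].
case/gballSP => [/IH[p [xp lp sp]]|[w /IH[p [xp lp sp]] wy]].
  by exists p; split => //; apply: leqW.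
by exists (rcons p y); rewrite rcons_path xp lp last_rcons size_rcons.
Qed.

Definition exits (k : nat) (x u w : V) :=
  [&& u \in gball k x, w \notin gball k x & adj G u w].

(** A ball that no edge leaves is closed under adjacency, so it is the whole component. *)
Lemma gball_closed (k : nat) (x z : V) :
  (forall u w, ~~ exits k x u w) -> connect (adj G) x z -> z \in gball k x.
Proof.
move=> noexit /connectP[p xp ->] {z}.
suff: forall y, y \in gball k x -> path (adj G) y p -> last y p \in gball k x.
  by apply; rewrite ?gball_center.
elim: p {xp} => [//|w p IH] y yB /= /andP[yw wp]; apply: IH => //.
by have := noexit y w; rewrite /exits yB yw andbT negbK.
Qed.

Section Growth.
Variables (a b r : nat).

(* A vertex is heavy if its degree is at least a / b.  As long as the component
   of x is not exhausted, each shell of width 2 r + 3 around x contains the whole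
   neighbourhood of some heavy vertex. *)
Hypothesis near_heavy : forall v : V,
  (exists2 h, h \in gball r v & (a <= b * deg G h)%N) \/
  (forall z, connect (adj G) v z -> z \in gball r v).

Let q := (2 * r + 3)%N.

Lemma gball_growth (x : V) (j : nat) :
  (forall y, connect (adj G) x y -> y \in gball (j * q) x) \/
  (j * a <= b * #|gball (j * q) x|)%N.
Proof.
elim: j => [|j [all|IH]]; first by right.
  left=> y /all; apply: gball_mono; lia.
(* Such a [u] is at distance exactly [j * q + r + 2] from [x]. A heavy vertex within [r] of [u] is
   then at distance at least [j * q + 2], so its neighbours miss the ball of radius [j * q] but lie
   in the one of radius [j * q + 2 * r + 3], which is the next radius. *)
have [/existsP[z /existsP[u /and3P[zB uB zu]]]|noexit] :=
    boolP [exists z, exists u, exits (j * q + r + 1) x z u]; last first.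
  left=> y xy; have : y \in gball (j * q + r + 1) x.
    apply: gball_closed xy => z u.
    by move/existsPn: noexit => /(_ z)/existsPn/(_ u).
  apply: gball_mono; rewrite /q; lia.
have uB' : u \in gball (j * q + r + 2) x.
  rewrite (_ : _ + 2 = (j * q + r + 1).+1)%N; last by rewrite addn1 addn2.
  exact: gball_step zB zu.
have [[h hB hdeg]|all] := near_heavy u; last first.
  (* If the component of [u] lies within [r] of [u], so does [x], but [u] is farther than [r] from
     [x]. *)
  have /all/gball_sym xu : connect (adj G) u x.
    by rewrite connect_adj_sym (gball_connect uB').
  case/negP: uB; apply: gball_mono xu; lia.
right; rewrite mulSn addnC; apply: (leq_trans (leq_add IH hdeg)).
rewrite -mulnDr leq_mul2l; apply/orP; right.
rewrite /deg -cardsUI.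
set N := (X in gball (j * q) x :&: X).
have -> : gball (j * q) x :&: N = finset.set0.
  apply/setP => w; rewrite !inE; apply/negbTE/negP => /andP[wB hw].
  case/negP: uB; have wu : u \in gball (1 + r) w.
    by apply: gball_add (gball_sym hB); rewrite gball_adj // adj_sym.
  by apply: gball_mono (gball_add wB wu); lia.
rewrite cards0 addn0; apply: subset_leq_card; apply/fintype.subsetP => w.
rewrite inE => /orP[|]; first by apply: gball_mono; rewrite /q; lia.
rewrite inE => hw; apply: gball_mono (gball_add uB' (gball_add hB (gball_adj hw))).
rewrite /q; lia.
Qed.

Lemma diameter_bound (x y : V) : (0 < a)%N -> connect (adj G) x y ->
  y \in gball (((b * #|V|) %/ a).+1 * q) x.
Proof.
(* With this many shells the second alternative would make the ball larger than [V]. *)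
move=> a0 xy; case: (gball_growth x (b * #|V| %/ a).+1) => [-> //|].
move/leq_trans/(_ (leq_mul (leqnn b) (max_card _))).
by rewrite leqNgt ltn_ceil.
Qed.

End Growth.
End Balls.

(** * Counting incidences of vertices and edges *)

Lemma deg_incident (V : finType) (G : sgraph V) (u : V) :
  deg G u = #|[set e in edges G | u \in e]%SET|.
Proof.
rewrite /deg -(@card_in_imset _ _ (fun v => [set u; v]%SET)) => [|v w]; last first.
  rewrite !inE => uv uw /setP/(_ w); rewrite !inE eqxx orbT.
  by rewrite eq_sym (negbTE (adj_neq uw)) => /eqP.
apply: eq_card => e; rewrite !inE; apply/imsetP/andP => [[v]|[eG ue]].
  by rewrite !inE => uv ->; split; rewrite ?inE ?eqxx.
have : #|e :\ u| = 1%N.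
  have /forall_inP/(_ _ eG)/eqP := edges_card2 G.
  by rewrite (cardsD1 u) ue => -[].
move/eqP/cards1P => [v ev]; exists v; last by rewrite -ev finset.setD1K.
by rewrite inE /adj -ev finset.setD1K.
Qed.

Lemma handshake (V : finType) (G : sgraph V) :
  (\sum_u deg G u = 2 * #|edges G|)%N.
Proof.
under eq_bigr do rewrite deg_incident -sum1_card big_mkcond /=.
rewrite exchange_big /=.
rewrite (bigID (mem (edges G))) /= [X in (_ + X)%N]big1 => [|e eG]; last first.
  by rewrite big1 // => u _; rewrite inE (negbTE eG).
rewrite addn0 mulnC -sum_nat_const; apply: eq_bigr => e eG.
have /forall_inP/(_ _ eG)/eqP <- := edges_card2 G.
by rewrite -sum1_card [RHS]big_mkcond; apply: eq_bigr => u _; rewrite inE eG.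
Qed.

(** * Cauchy-Schwarz, means, and a quadratic recurrence *)

Section RealSums.
Variable R : realType.

Lemma sum_weighted_sqr_le (I : Type) (s : seq I) (P : pred I) (w g : I -> R) :
  (forall i, 0 <= w i) ->
  (\sum_(i <- s | P i) w i * g i) ^+ 2 <=
  (\sum_(i <- s | P i) w i) * (\sum_(i <- s | P i) w i * g i ^+ 2).
Proof.
move=> w0; set S := \sum_(i <- s | P i) w i; set T := \sum_(i <- s | P i) w i * g i.
set Q := \sum_(i <- s | P i) w i * g i ^+ 2.
have var_ge0 c : 0 <= Q - 2 * c * T + c ^+ 2 * S.
  rewrite /Q /T /S !mulr_sumr -sumrB -big_split /=; apply: sumr_ge0 => i _.
  rewrite (_ : _ + _ = w i * (g i - c) ^+ 2); last by ring.
  by rewrite mulr_ge0 // sqr_ge0.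
have : 0 <= S by apply: sumr_ge0.
rewrite le_eqVlt => /predU1P[S0|S0]; last first.
  (* For [S > 0] this is the [c] that minimises the quadratic. *)
  have := var_ge0 (T / S).
  have -> : Q - 2 * (T / S) * T + (T / S) ^+ 2 * S = (S * Q - T ^+ 2) / S.
    by field; rewrite gt_eqF.
  by rewrite pmulr_lge0 ?invr_gt0 // subr_ge0.
have [-> | T0] := eqVneq T 0; first by rewrite -S0 mul0r expr0n.
(* For [S = 0] the quadratic is affine in [c]; if [T] were nonzero, this [c] would give it the value
   -1. *)
have := var_ge0 ((Q + 1) / (2 * T)); rewrite -S0.
rewrite (_ : _ + _ = -1); first by rewrite lerNr oppr0 ler10.
by field.
Qed.

Lemma sum_sqr_le (I : Type) (s : seq I) (P : pred I) (g : I -> R) :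
  (\sum_(i <- s | P i) g i) ^+ 2 <=
  (count P s)%:R * \sum_(i <- s | P i) g i ^+ 2.
Proof.
have := @sum_weighted_sqr_le _ s P (fun=> 1) g (fun=> ler01).
have mul1 (f : I -> R) : \sum_(i <- s | P i) 1 * f i = \sum_(i <- s | P i) f i.
  by apply: eq_bigr => i _; rewrite mul1r.
by rewrite big_const_seq iter_addr_0 mul1 (mul1 (fun i => g i ^+ 2)).
Qed.

Lemma exists_ge_mean (I : finType) (p g : I -> R) :
  (forall i, 0 <= p i) -> \sum_i p i = 1 -> exists x, \sum_i p i * g i <= g x.
Proof.
move=> p0 p1; set S := \sum_i p i * g i; apply: contrapT => noge.
have lt x : g x < S by rewrite ltNge; apply/negP => Sx; apply: noge; exists x.
have /eqP : \sum_i p i * (S - g i) = 0.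
  under eq_bigr do rewrite mulrBr.
  by rewrite sumrB -mulr_suml p1 mul1r subrr.
rewrite psumr_eq0 => [/allP z|i _]; last by rewrite mulr_ge0 // subr_ge0 ltW.
have /eqP := oner_neq0 R; apply; rewrite -p1 big1 // => i _.
have := z i (mem_index_enum i).
by rewrite /= mulf_eq0 subr_eq0 (gt_eqF (lt i)) orbF => /eqP.
Qed.

(** Discrete form of b' = - b^2 / A, whose solutions decay like A / t. The induction multiplies by A
    + b_t, because (A b - b^2)(A + b) = b (A^2 - b^2) is at most b A^2. *)
Lemma quadratic_decay (b : nat -> R) (A : R) :
  0 < A -> (forall t, 0 <= b t) ->
  (forall t, b t ^+ 2 <= A * (b t - b t.+1)) -> forall t, t%:R * b t <= A.
Proof.
move=> A0 b0 dec; elim=> [|t IH]; first by rewrite mul0r ltW.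
have t0 : 0 <= t%:R :> R by [].
have S0 : 0 < A + b t by rewrite ltr_wpDr.
rewrite -(ler_pM2r S0) -(ler_pM2l A0).
have := dec t; have := b0 t; have := b0 t.+1; rewrite -natr1.
move: (t%:R) (b t) (b t.+1) t0 S0 IH => x y z x0 S0 IH z0 y0 d.
have d' : (x + 1) * (A * z) <= (x + 1) * (A * y - y ^+ 2).
  by rewrite ler_wpM2l ?addr_ge0 //; lra.
apply: (@le_trans _ _ ((x + 1) * (A * y - y ^+ 2) * (A + y))).
  by rewrite mulrA [A * (_ * z)]mulrCA ler_wpM2r // ltW.
have E1 : (x + 1) * (A * y - y ^+ 2) * (A + y) =
   (x + 1) * y * A ^+ 2 - (x + 1) * y ^+ 3 by ring.
rewrite E1; apply: (@le_trans _ _ ((x + 1) * y * A ^+ 2)).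
  by rewrite gerBl mulr_ge0 ?exprn_ge0 ?addr_ge0.
rewrite (_ : A * _ = (A + y) * A ^+ 2); last by ring.
by rewrite ler_pM2r ?exprn_gt0 //; lra.
Qed.

End RealSums.

(** * Mixing of the lazy walk on a graph of bounded diameter *)

Section LazyWalkMixing.
Variables (R : realType) (V : finType) (H : sgraph V).

Let d (v : V) : R := (deg H v)%:R.
Let M : R := \sum_v d v.

Lemma sum_adj_const (v : V) (c : R) : \sum_(u | adj H v u) c = d v * c.
Proof.
by rewrite sumr_const mulr_natl /d /deg; congr (_ *+ _); apply: eq_card => u; rewrite !inE.
Qed.

Lemma sum_adj_exchange (F : V -> V -> R) :
  \sum_v \sum_(u | adj H v u) F v u = \sum_v \sum_(u | adj H v u) F u v.
Proof.
under eq_bigr do rewrite big_mkcond.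
rewrite exchange_big /=; apply: eq_bigr => v _; rewrite [RHS]big_mkcond.
by apply: eq_bigr => u _; rewrite adj_sym.
Qed.

(** The Dirichlet form up to normalisation; every edge is counted in both directions. *)
Definition energy (g : V -> R) : R :=
  \sum_v \sum_(u | adj H v u) (g v - g u) ^+ 2.

(** Telescoping along the path, then Cauchy-Schwarz over its darts. *)
Lemma path_energy (g : V -> R) (x : V) (p : seq V) :
  path (adj H) x p -> uniq (x :: p) ->
  (g x - g (last x p)) ^+ 2 <= (size p)%:R * energy g.
Proof.
move=> xp up; pose s := zip (x :: p) p.
have -> : g x - g (last x p) = \sum_(e <- s) (g e.1 - g e.2).
  rewrite /s; elim: p x {xp up s} => [|y p IH] x /=.
    by rewrite big_nil subrr.
  by rewrite big_cons -IH /= addrA subrK.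
have ss : size s = size p by rewrite size_zip /= (minn_idPr (leqnSn _)).
apply: (le_trans (sum_sqr_le _ _ _)).
rewrite count_predT ss ler_wpM2l // /energy pair_big_dep /=.
(* On a simple path the heads of the darts are distinct, so each term of the energy occurs at most
   once. *)
have us : uniq s.
  by apply: (@map_uniq _ _ snd); rewrite -/unzip2 unzip2_zip ?leqnSn //; case/andP: up.
have sE : all (fun e => adj H e.1 e.2) s.
  rewrite /s; elim: p x xp {up s us ss} => [//|y p IH] x /= /andP[-> yp].
  exact: IH.
rewrite big_uniq //= [leLHS]big_mkcond [leRHS]big_mkcond /=.
apply: ler_sum => -[u v] _ /=; case: ifP => [/(allP sE) /= -> //|_].
by case: ifP => // _; apply: sqr_ge0.
Qed.

Lemma gball_energy (g : V -> R) (L : nat) (x y : V) :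
  y \in gball H L x -> (g x - g y) ^+ 2 <= L%:R * energy g.
Proof.
case/gball_path => p [xp <- up sp]; apply: (le_trans (path_energy g xp up)).
rewrite ler_wpM2r ?ler_nat //; do 2![apply: sumr_ge0 => ? _].
exact: sqr_ge0.
Qed.

Hypothesis deg_gt0 : forall v, (0 < deg H v)%N.

Lemma d_gt0 v : 0 < d v. Proof. by rewrite ltr0n. Qed.

Definition lazy_avg (g : V -> R) (v : V) : R :=
  g v / 2 + (\sum_(u | adj H v u) g u) / (2 * d v).

(* The variance removed by one lazy step, by Jensen's inequality applied to the
   midpoints (g v + g u) / 2. *)
Lemma lazy_avg_contraction (g : V -> R) :
  \sum_v d v * lazy_avg g v ^+ 2 <= \sum_v d v * g v ^+ 2 - energy g / 4.
Proof.
have -> : \sum_v d v * g v ^+ 2 - energy g / 4 =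
    \sum_v \sum_(u | adj H v u) ((g v + g u) / 2) ^+ 2.
  have E (v u : V) : ((g v + g u) / 2) ^+ 2 =
    g v ^+ 2 / 2 + g u ^+ 2 / 2 - (g v - g u) ^+ 2 / 4 by field.
  under [RHS]eq_bigr do under eq_bigr do rewrite E.
  under [RHS]eq_bigr do rewrite sumrB big_split /=.
  rewrite sumrB big_split /= (sum_adj_exchange (fun v u => g u ^+ 2 / 2)).
  rewrite -big_split /=; congr (_ - _).
    by apply: eq_bigr => v _; rewrite sum_adj_const; field.
  by rewrite /energy mulr_suml; apply: eq_bigr => v _; rewrite mulr_suml.
apply: ler_sum => v _.
have d0 := d_gt0 v.
have -> : lazy_avg g v = (\sum_(u | adj H v u) (g v + g u) / 2) / d v.
  rewrite -mulr_suml big_split /= sum_adj_const /lazy_avg.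
  by field; rewrite gt_eqF.
have := @sum_sqr_le R _ (index_enum V) (adj H v) (fun u => (g v + g u) / 2).
have -> : (count (adj H v) (index_enum V))%:R = d v.
  by rewrite -[RHS]mulr1 -sum_adj_const big_const_seq iter_addr_0.
move: (\sum_(u | _) _) (\sum_(u | _) _) => Q S SQ.
have -> : d v * (S / d v) ^+ 2 = S ^+ 2 / d v by field; rewrite gt_eqF.
by rewrite ler_pdivrMr // mulrC.
Qed.

Fixpoint density (i : V) (t : nat) : V -> R :=
  if t is t'.+1 then lazy_avg (density i t')
  else fun v => (v == i)%:R * M / d v.

Variable i : V.

Lemma M_gt0 : 0 < M.
Proof.
rewrite /M (bigD1 i) //= ltr_pwDl ?d_gt0 //.
by apply: sumr_ge0 => v _; rewrite ltW ?d_gt0.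
Qed.

Lemma stationaryE v : stationary R H v = d v / M.
Proof. by rewrite /stationary -natrM -handshake natr_sum. Qed.

Lemma stationary_ge0 v : 0 <= stationary R H v.
Proof. by rewrite stationaryE divr_ge0 ?ltW ?d_gt0 ?M_gt0. Qed.

Lemma sum_stationary : \sum_v stationary R H v = 1.
Proof.
under eq_bigr do rewrite stationaryE.
by rewrite -mulr_suml divff // gt_eqF ?M_gt0.
Qed.

Lemma lazy_step_ge0 u v : 0 <= lazy_step R H u v.
Proof.
rewrite /lazy_step; case: ifP => _; first by rewrite invr_ge0.
by case: ifP => // _; rewrite invr_ge0 mulr_ge0.
Qed.

Lemma sum_lazy_step u : \sum_v lazy_step R H u v = 1.
Proof.
rewrite (bigD1 u) //= {1}/lazy_step eqxx.
have -> : \sum_(v | v != u) lazy_step R H u v =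
    \sum_(v | adj H u v) (2 * d u)^-1.
  rewrite [LHS]big_mkcond [RHS]big_mkcond; apply: eq_bigr => v _.
  rewrite /lazy_step; case: (eqVneq v u) => [->|_ //=].
  by rewrite adj_irr.
rewrite sum_adj_const; have := d_gt0 u => du; field; by rewrite gt_eqF.
Qed.

Lemma walk_dist_ge0 t v : 0 <= walk_dist R H i t v.
Proof.
elim: t v => [|t IH] v //=; apply: sumr_ge0 => u _.
by rewrite mulr_ge0 ?lazy_step_ge0.
Qed.

Lemma sum_walk_dist t : \sum_v walk_dist R H i t v = 1.
Proof.
elim: t => [|t IH] /=.
  by rewrite (bigD1 i) //= eqxx big1 ?addr0 // => v /negbTE ->.
rewrite exchange_big /= -[RHS]IH; apply: eq_bigr => u _.
by rewrite -mulr_sumr sum_lazy_step mulr1.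
Qed.

(** Reversibility: at stationarity every dart carries the same flow 1 / (2 M), so the density
    relative to the stationary law evolves by the averaging operator [lazy_avg] itself. *)
Lemma walk_density t v :
  walk_dist R H i t v = stationary R H v * density i t v.
Proof.
have M0 := M_gt0.
elim: t v => [|t IH] v; rewrite stationaryE; have d0 := d_gt0 v.
  by rewrite /=; field; rewrite !gt_eqF.
rewrite /= (bigD1 v) //= {1}/lazy_step eqxx IH stationaryE.
have -> : \sum_(u | u != v) walk_dist R H i t u * lazy_step R H u v =
    \sum_(u | adj H v u) density i t u / (2 * M).
  rewrite [LHS]big_mkcond [RHS]big_mkcond; apply: eq_bigr => u _.
  rewrite /lazy_step adj_sym; case: (eqVneq u v) => [->|_ /=].
    by rewrite adj_irr.
  case: ifP => _; last by rewrite mulr0.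
  have du := d_gt0 u; rewrite IH stationaryE -/(d u).
  by field; rewrite !gt_eqF.
rewrite -mulr_suml /lazy_avg; field; by rewrite !gt_eqF.
Qed.

(** The chi-square distance to stationarity, that is, the variance of the density. *)
Let b t := \sum_v stationary R H v * (density i t v - 1) ^+ 2.

Lemma mean_density_sub1 t : \sum_v stationary R H v * (density i t v - 1) = 0.
Proof.
under eq_bigr do rewrite mulrBr mulr1 -walk_density.
by rewrite sumrB sum_walk_dist sum_stationary subrr.
Qed.

(* The walk itself is the measure with density [density i t], so [b t] is the
   mean of [density i t - 1] under it. *)
Lemma chi2_mean t :
  b t = \sum_v walk_dist R H i t v * (density i t v - 1).
Proof.
rewrite -[RHS]subr0 -[X in _ - X](mean_density_sub1 t) -sumrB; apply: eq_bigr => v _.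
by rewrite walk_density; ring.
Qed.

Lemma chi2_ge0 t : 0 <= b t.
Proof.
by apply: sumr_ge0 => v _; rewrite mulr_ge0 ?stationary_ge0 ?sqr_ge0.
Qed.

Variable L : nat.
Hypothesis L_gt0 : (0 < L)%N.
Hypothesis small_diameter : forall x y, y \in gball H L x.

(** As [b t] is the mean of the density minus 1 under the walk, some [x] has density at least
    [1 + b t]; as the stationary mean is 1, some [y] has density at most 1. A path of length at most
    [L] joins them, so the energy is at least [b t ^+ 2 / L], and one step removes a quarter of the
    energy from [M * b t]. *)
Lemma chi2_decrease t : b t ^+ 2 <= 4 * M * L%:R * (b t - b t.+1).
Proof.
have [x bx] := exists_ge_mean (fun v => density i t v - 1)
  (walk_dist_ge0 t) (sum_walk_dist t).
have [y by0] := exists_ge_mean (fun v => 1 - density i t v)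
  stationary_ge0 sum_stationary.
move: bx; rewrite -chi2_mean => bx.
have y1 : density i t y <= 1.
  rewrite -subr_ge0; apply: le_trans by0.
  under eq_bigr do rewrite -opprB mulrN.
  by rewrite sumrN mean_density_sub1 oppr0.
have b2 : b t ^+ 2 <= L%:R * energy (density i t).
  apply: le_trans (gball_energy (density i t) (small_diameter x y)).
  by rewrite ler_sqr ?nnegrE ?chi2_ge0 //; have := chi2_ge0 t; lra.
apply: (le_trans b2); rewrite [4 * M * _]mulrC -mulrA ler_wpM2l //.
have M0 := M_gt0.
have bE s : M * b s = \sum_v d v * (density i s v - 1) ^+ 2.
  rewrite /b mulr_sumr; apply: eq_bigr => v _.
  by rewrite stationaryE; field; rewrite gt_eqF.
suff : M * b t.+1 <= M * b t - energy (density i t) / 4 by lra.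
have := lazy_avg_contraction (fun v => density i t v - 1).
rewrite -!bE; have -> : energy (fun v => density i t v - 1) = energy (density i t).
  by do 2![apply: eq_bigr => ? _]; congr (_ ^+ 2); ring.
suff -> : \sum_v d v * lazy_avg (fun v => density i t v - 1) v ^+ 2 = M * b t.+1 by [].
rewrite bE; apply: eq_bigr => v _; congr (_ * _ ^+ 2) => /=.
have d0 := d_gt0 v.
rewrite /lazy_avg sumrB sum_adj_const; field; by rewrite gt_eqF.
Qed.

(** Cauchy-Schwarz on each event [A], with the stationary law as weights; its mass on [A] is at most
    1. *)
Lemma dTV_chi2 t : dTV (walk_dist R H i t) (stationary R H) <= Num.sqrt (b t).
Proof.
rewrite /dTV; elim/big_ind: _ => [|x y xb yb|A _]; first exact: sqrtr_ge0.
  by rewrite ge_max xb.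
rewrite -sumrB; under eq_bigr do rewrite walk_density -{2}[stationary _ _ _]mulr1 -mulrBr.
rewrite -sqrtr_sqr ler_sqrt ?chi2_ge0 //.
apply: (le_trans (sum_weighted_sqr_le _ _ _ stationary_ge0)).
rewrite -[leRHS]mul1r; apply: ler_pM.
- by apply: sumr_ge0 => v _; exact: stationary_ge0.
- by apply: sumr_ge0 => v _; rewrite mulr_ge0 ?stationary_ge0 ?sqr_ge0.
- rewrite -sum_stationary [leRHS](bigID (mem A)) /= lerDl.
  by apply: sumr_ge0 => v _; exact: stationary_ge0.
rewrite /b [leRHS](bigID (mem A)) /= lerDl.
by apply: sumr_ge0 => v _; rewrite mulr_ge0 ?stationary_ge0 ?sqr_ge0.
Qed.

(** The bound exp x > 1 + x at x = -1/2 shows that the square root of e is below 2. *)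
Lemma expR1_lt4 : expR 1 < 4 :> R.
Proof.
have : 2^-1 < expR (- 2^-1) :> R.
  by have := @expR_gt1Dx R (- 2^-1); rewrite oppr_eq0 invr_eq0 pnatr_eq0 => /(_ isT); lra.
rewrite expRN ltf_pV2 ?posrE ?expR_gt0 // => e2.
have -> : expR 1 = expR 2^-1 * expR 2^-1 :> R.
  by rewrite -expRD; congr expR; field.
rewrite (_ : 4 = 2 * 2 :> R); last by ring.
by apply: ltr_pM; rewrite ?expR_ge0.
Qed.

Lemma dTV_small t : 64 * M * L%:R < t%:R ->
  dTV (walk_dist R H i t) (stationary R H) < (expR 1)^-1.
Proof.
move=> tA; apply: (le_lt_trans (dTV_chi2 t)).
have A0 : 0 < 4 * M * L%:R by rewrite !mulr_gt0 ?M_gt0 ?ltr0n.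
have := quadratic_decay A0 chi2_ge0 chi2_decrease t => tb.
(* Since 64 = 16 * 4, the decay gives [b t < 1 / 16], hence a distance below 1/4 < 1/e. *)
have b16 : b t < 4^-1 ^+ 2.
  rewrite -(ltr_pM2l A0) ltNge; apply/negP.
  have := chi2_ge0 t; move: tA tb A0; move: (b t) (t%:R : R) => x y.
  rewrite (_ : 64 * M * L%:R = 16 * (4 * M * L%:R)); last by ring.
  move: (4 * M * L%:R) => A yA yx A0 x0 H1.
  have x1 : 16^-1 <= x.
    by rewrite -(ler_pM2l A0); move: H1; lra.
  have : 16 * A * x < y * x by rewrite ltr_pM2r //; lra.
  lra.
have : Num.sqrt (b t) < Num.sqrt (4^-1 ^+ 2) by rewrite ltr_sqrt.
rewrite sqrtr_sqr ger0_norm ?invr_ge0 // => /lt_le_trans; apply.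
by rewrite lef_pV2 ?posrE ?expR_gt0 // ltW ?expR1_lt4.
Qed.

End LazyWalkMixing.

Lemma mixing_time_le (R : realType) (V : finType) (H : sgraph V) (L : nat) :
  (forall v, (0 < deg H v)%N) -> (0 < L)%N ->
  (forall x y, y \in gball H L x) ->
  (mixing_time R H <= ((64 * (\sum_v deg H v) * L).+1%:R)%:E)%E.
Proof.
move=> dH L0 HL; apply: ge_ereal_sup => _ [i _ <-].
apply: ereal_inf_lbound; exists (64 * (\sum_v deg H v) * L).+1 => //.
by apply: (dTV_small dH i L0 HL); rewrite -natr_sum -!natrM ltr_nat.
Qed.

(** * Switchings and the number of graphs with a light ball *)

Section Switching.
Variable V : finType.
Implicit Types (G : sgraph V) (u w x y z : V).

Definition switched_edges G u w x y : {set {set V}} :=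
  ([set u; x] |: ([set w; y] |: (edges G :\ [set u; w] :\ [set x; y])))%SET.

(* The four-cycle u w y x is switched; G itself is the junk value when the new
   edges would be loops. *)
Definition switch G u w x y : sgraph V := insubd G (switched_edges G u w x y).

Lemma edges_switch G u w x y : u != x -> w != y ->
  edges (switch G u w x y) = switched_edges G u w x y.
Proof.
move=> ux wy; apply: (@insubdK _ _ (sgraph V)); apply/forall_inP => e.
rewrite !inE => /or3P[/eqP->|/eqP->|/and3P[_ _ eG]]; rewrite ?cards2 ?ux ?wy //.
by have /forall_inP/(_ _ eG) := edges_card2 G.
Qed.

Lemma set2_eq (a b c d : V) : [set a; b]%SET = [set c; d]%SET ->
  (a = c /\ b = d) \/ (a = d /\ b = c).
Proof.
move=> E; have mem z : (z \in [set a; b]%SET) = (z \in [set c; d]%SET) by rewrite E.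
have := mem a; have := mem b; have := mem c; have := mem d.
rewrite !inE !eqxx /= !orbT => /pred2P dab /pred2P cab /esym/pred2P bcd /esym/pred2P acd.
by case: dab cab bcd acd => -> [] -> [] ? [] ?; subst; tauto.
Qed.

Definition switchable G u w x y :=
  [&& adj G u w, adj G x y, ~~ adj G u x, ~~ adj G w y, u != x & w != y].

Section Switchable.
Variables (G : sgraph V) (u w x y : V).
Hypothesis sw : switchable G u w x y.

Let uw : adj G u w. Proof. by case/and5P: sw. Qed.
Let xy : adj G x y. Proof. by case/and5P: sw. Qed.
Let ux' : ~~ adj G u x. Proof. by case/and5P: sw. Qed.
Let wy' : ~~ adj G w y. Proof. by case/and5P: sw. Qed.
Let ux : u != x. Proof. by case/and5P: sw => _ _ _ _ /andP[]. Qed.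
Let wy : w != y. Proof. by case/and5P: sw => _ _ _ _ /andP[]. Qed.

Lemma uw_neq_xy : [set u; w]%SET != [set x; y]%SET.
Proof.
apply/eqP => /set2_eq[[/eqP]|[_ wx]]; first by rewrite (negbTE ux).
by move: ux'; rewrite -wx uw.
Qed.

Lemma ux_neq_wy : [set u; x]%SET != [set w; y]%SET.
Proof.
apply/eqP => /set2_eq[[/eqP]|[_ xw]]; first by rewrite (negbTE (adj_neq uw)).
by move: ux'; rewrite xw uw.
Qed.

Lemma adj_switch p z :
  adj (switch G u w x y) p z =
  [|| [set p; z]%SET == [set u; x]%SET, [set p; z]%SET == [set w; y]%SET |
   [&& [set p; z]%SET != [set x; y]%SET, [set p; z]%SET != [set u; w]%SET
     & adj G p z]].
Proof. by rewrite /adj edges_switch // !inE. Qed.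

Lemma adj_switch_other p z : p \notin [:: u; w; x; y] ->
  adj (switch G u w x y) p z = adj G p z.
Proof.
rewrite !inE !negb_or => /and4P[pu pw px py]; rewrite adj_switch.
have no a b : p != a -> p != b -> ([set p; z]%SET == [set a; b]%SET) = false.
  move=> pa pb; apply/negP => /eqP/set2_eq[[/eqP]|[/eqP]].
    by rewrite (negbTE pa).
  by rewrite (negbTE pb).
by rewrite !no.
Qed.

(** The removed edges [u w], [x y] and the added edges [u x], [w y] cover each vertex equally
    often. *)
Lemma deg_switch p : deg (switch G u w x y) p = deg G p.
Proof.
have dE (H : sgraph V) : deg H p = (\sum_(e in edges H) (p \in e))%N.
  rewrite deg_incident -sum1_card [RHS]big_mkcond [LHS]big_mkcond /=.
  by apply: eq_bigr => e _; rewrite inE; case: (e \in edges H); case: (p \in e).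
rewrite !dE edges_switch // /switched_edges.
have ab : [set x; y]%SET \in (edges G :\ [set u; w])%SET.
  by rewrite !inE eq_sym uw_neq_xy.
rewrite [RHS](big_setD1 _ uw) /= [in RHS](big_setD1 _ ab) /=.
rewrite big_setU1 /=; last first.
  by rewrite !inE (negbTE ux_neq_wy) /= -/(adj G u x) (negbTE ux') !andbF.
rewrite big_setU1 /=; last by rewrite !inE -/(adj G w y) (negbTE wy') !andbF.
rewrite !addnA; congr (_ + _)%N; rewrite !inE.
have split2 (a b : V) : a != b -> ((p == a) || (p == b)) = ((p == a) + (p == b))%N :> nat.
  by case: (eqVneq p a) => [->|//]; move/negbTE => ->.
by rewrite !split2 ?(adj_neq uw) ?(adj_neq xy) //; lia.
Qed.

Lemma switch_inv : edges G =
  ([set u; w] |: ([set x; y] |: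
     (edges (switch G u w x y) :\ [set u; x] :\ [set w; y])))%SET.
Proof.
apply/setP => e; rewrite edges_switch // !inE.
have [->|eab] /= := eqVneq e [set u; w]%SET; first by rewrite -/(adj G u w) uw.
have [->|ecd] /= := eqVneq e [set x; y]%SET; first by rewrite -/(adj G x y) xy.
have [->|_] /= := eqVneq e [set u; x]%SET.
  by rewrite -/(adj G u x) (negbTE ux') !andbF.
by have [->|_] //= := eqVneq e [set w; y]%SET; rewrite -/(adj G w y) (negbTE wy').
Qed.

(** Below radius [k] the ball contains none of the four vertices: [w], [x], [y] are outside radius
    [k], and [u] would bring [w] inside. So each step of its growth is unchanged. *)
Lemma gball_switch k v : exits G k v u w ->
  x \notin gball G k v -> y \notin gball G k v ->
  gball (switch G u w x y) k v = gball G k v.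
Proof.
case/and3P => uB wB _ xB yB.
suff: forall j, (j <= k)%N -> gball (switch G u w x y) j v = gball G j v.
  exact.
elim=> [//|j IH] jk; apply/setP => z; rewrite /= IH ?(ltnW jk) // !inE.
congr (_ || _); apply: eq_existsb => p; case: (boolP (p \in _)) => //= pB.
apply: adj_switch_other; apply/negP.
have outB q : q \notin gball G k v -> p <> q.
  by move=> qB pq; case/negP: qB; rewrite -pq (gball_mono (ltnW jk)).
rewrite !inE => /or4P[/eqP pu|/eqP/(outB _ wB)|/eqP/(outB _ xB)|/eqP/(outB _ yB)] //.
by case/negP: wB; apply: gball_mono jk _; apply: gball_step pB _; rewrite pu.
Qed.

End Switchable.

Lemma card_dart_pred G (P : pred V) :
  #|[set p : V * V | P p.1 & adj G p.1 p.2]%SET| = (\sum_(u | P u) deg G u)%N.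
Proof.
rewrite -sum1_card /deg.
under [RHS]eq_bigr do rewrite -sum1_card.
by rewrite pair_big_dep /=; apply: eq_bigl => -[u w]; rewrite !inE.
Qed.

Section LightBalls.
Variables (d : V -> nat) (light : pred V).

Definition with_degrees : {set sgraph V} :=
  [set G : sgraph V | [forall i, deg G i == d i]]%SET.

(** The exit expresses that the ball does not exhaust the component of [v]. *)
Definition light_ball G k v :=
  [forall u in gball G k v, light u] &&
  [exists p : V * V, exits G k v p.1 p.2].

Definition light_ball_graphs k v : {set sgraph V} :=
  [set G in with_degrees | light_ball G k v]%SET.

Let heavy_darts G := [set p : V * V | [&& adj G p.1 p.2, ~~ light p.1 & ~~ light p.2]]%SET.
Let light_darts G := [set p : V * V | light p.1 & adj G p.1 p.2]%SET.

Lemma card_light_darts G : G \in with_degrees ->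
  #|light_darts G| = (\sum_(u | light u) d u)%N.
Proof.
rewrite inE => /forallP dG; rewrite card_dart_pred.
by apply: eq_bigr => u _; apply/eqP.
Qed.

(** A dart that is not heavy has a light tail, or its reverse does. *)
Lemma card_heavy_darts G : G \in with_degrees ->
  (\sum_u d u <= #|heavy_darts G| + 2 * \sum_(u | light u) d u)%N.
Proof.
move=> dG; rewrite -(card_light_darts dG).
have -> : (\sum_u d u)%N = #|[set p : V * V | predT p.1 & adj G p.1 p.2]%SET|.
  rewrite card_dart_pred; move: dG; rewrite inE => /forallP dG.
  by apply: eq_bigr => u _; apply/esym/eqP.
pose swap (p : V * V) := (p.2, p.1).
rewrite mul2n -addnn addnA -{2}(card_imset (light_darts G) (_ : injective swap)); last first.
  by move=> [a b] [a' b'] [-> ->].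
apply: leq_trans (leq_trans (leq_card_setU _ _) (leq_add (leq_card_setU _ _) (leqnn _))).
apply: subset_leq_card; apply/fintype.subsetP => -[a b]; rewrite !inE /= => ab.
rewrite ab /=; case: (boolP (light a)) => //= _; rewrite ?orbT //.
case: (boolP (light b)) => //= lb; apply/imsetP; exists (b, a) => //.
by rewrite inE /= lb adj_sym.
Qed.

Variables (k : nat) (v : V).

(** One exit chosen per graph; the default does not arise when the ball of radius [k.+2] is a light
    ball. *)
Let exit_of G : V * V := odflt (v, v) [pick p | exits G k v p.1 p.2].

Let light_gball G (u : V) (j : nat) :
  light_ball G k.+2 v -> (j <= k.+2)%N -> u \in gball G j v -> light u.
Proof. by case/andP => /forall_inP l _ jk /(gball_mono jk)/l. Qed.

Lemma exit_ofP G : light_ball G k.+2 v ->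
  exits G k v (exit_of G).1 (exit_of G).2.
Proof.
case/andP => _ /existsP[e /and3P[aB bB ab]].
rewrite /exit_of; case: pickP => //= noexit.
case/negP: bB; apply: gball_mono (_ : k <= k.+2)%N _; first lia.
apply: gball_closed => [p q|]; first by have := noexit (p, q) => /= ->.
exact: connect_trans (gball_connect aB) (connect1 ab).
Qed.

(** This is why the radius grows by 2: all neighbours of [u] and [w] lie in the light ball, so with
    [x] and [y] heavy neither [u x] nor [w y] is an edge yet. *)
Let switchP G x y (u := (exit_of G).1) (w := (exit_of G).2) :
  light_ball G k.+2 v -> (x, y) \in heavy_darts G ->
  [/\ switchable G u w x y, light u, light w,
      x \notin gball G k v & y \notin gball G k v].
Proof.
move=> lG; have lB := light_gball lG.
have := exit_ofP lG; rewrite -/u -/w => /and3P[uB wB uw].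
rewrite inE /= => /and3P[xy hx hy].
have lu : light u by apply: (lB _ k) => //; lia.
have wB1 := gball_step uB uw.
have lw : light w by apply: (lB _ k.+1).
split => //.
- rewrite /switchable uw xy /=; apply/and4P; split.
  + by apply: contra hx => ux; apply: (lB _ k.+1) => //; exact: gball_step ux.
  + by apply: contra hy => wy; apply: (lB _ k.+2) => //; exact: gball_step wy.
  + by apply: contraNneq hx => <-.
  + by apply: contraNneq hy => <-.
- by apply: contra hx; apply: lB; lia.
- by apply: contra hy; apply: lB; lia.
Qed.

(* A switching joins the light ball to a heavy vertex x.  It is undone from the
   light-tailed dart (w, y), as u x is the only edge from the ball to a heavy
   vertex. *)
Let switching (t : sgraph V * (V * V)) : sgraph V * (V * V) :=
  let: (u, w) := exit_of t.1 in (switch t.1 u w t.2.1 t.2.2, (w, t.2.2)).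

Let source := [set t : sgraph V * (V * V) |
  (t.1 \in light_ball_graphs k.+2 v) && (t.2 \in heavy_darts t.1)]%SET.

Let target := [set t : sgraph V * (V * V) |
  (t.1 \in light_ball_graphs k v) && (t.2 \in light_darts t.1)]%SET.

Lemma switching_target t : t \in source -> switching t \in target.
Proof.
case: t => G [x y]; rewrite inE [_ \in light_ball_graphs _ _]inE /=.
case/andP => /andP[dG lG] xyH; rewrite /switching /=.
have [sw lu lw xB yB] := switchP lG xyH; have ex := exit_ofP lG.
move: sw lu lw ex; case: (exit_of G) => u w /= sw lu lw ex.
have ballE := gball_switch sw ex xB yB.
rewrite inE /= inE; apply/andP; split; last first.
  by rewrite inE /= lw adj_switch // eqxx orbT.
apply/andP; split.
  by rewrite inE; apply/forallP => p; rewrite deg_switch //; move: dG; rewrite inE => /forallP.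
apply/andP; split.
  by rewrite ballE; apply/forall_inP => p; apply: (light_gball lG); lia.
apply/existsP; exists (u, x); rewrite /exits /= ballE xB adj_switch // eqxx /= andbT.
by case/and3P: ex.
Qed.

Lemma switching_inj : {in source &, injective switching}.
Proof.
move=> [G [x y]] [G2 [x2 y2]].
rewrite inE [_ \in light_ball_graphs _ _]inE /= => /andP[/andP[_ lG] xyH].
rewrite inE [_ \in light_ball_graphs _ _]inE /= => /andP[/andP[_ lG2] xyH2].
rewrite /switching /=.
have [sw lu lw xB yB] := switchP lG xyH; have ex := exit_ofP lG.
have [sw2 lu2 lw2 xB2 yB2] := switchP lG2 xyH2; have ex2 := exit_ofP lG2.
move: sw lu lw ex sw2 lu2 lw2 ex2; case: (exit_of G) => u w; case: (exit_of G2) => u2 w2 /=.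
move=> sw lu lw ex sw2 lu2 lw2 ex2 [GG ww yy]; subst w2 y2.
have ballE := gball_switch sw ex xB yB.
have ballE2 := gball_switch sw2 ex2 xB2 yB2.
have u2B : u2 \in gball G k v by rewrite -ballE GG ballE2; case/and3P: ex2.
move: xyH xyH2; rewrite !inE /= => /and3P[_ hx hy] /and3P[_ hx2 _].
(* In the common image [u2 x2] joins the ball to a heavy vertex. It is not [w y], as [w] is light
   and outside the ball, nor an old edge of [G], whose far end would be light. So it is [u x], and
   switching back recovers [G]. *)
have : adj (switch G u w x y) u2 x2 by rewrite GG adj_switch // eqxx.
rewrite adj_switch // => /or3P[/eqP/set2_eq|/eqP/set2_eq|/and3P[_ _ ux2]].
- case=> -[E1 E2]; last by case/negP: hx2; rewrite E2.
  subst u2 x2; congr (_, _); apply: val_inj => /=.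
  by rewrite (switch_inv sw) (switch_inv sw2) GG.
- case=> -[E1 E2]; last by case/negP: hx2; rewrite E2.
  by case/and3P: ex => _ /negP[]; rewrite -E1.
- by case/negP: hx2; apply: (light_gball lG) (gball_step u2B ux2).
Qed.

Lemma light_ball_graphs_step :
  (8 * \sum_(u | light u) d u <= \sum_u d u)%N -> (0 < \sum_u d u)%N ->
  (6 * #|light_ball_graphs k.+2 v| <= #|light_ball_graphs k v|)%N.
Proof.
move=> L8 s0; set s := (\sum_u d u)%N in L8 s0 *; set L := (\sum_(u | _) _)%N in L8 *.
have : (#|source| <= #|target|)%N.
  rewrite -(card_in_imset switching_inj); apply: subset_leq_card.
  by apply/fintype.subsetP => _ /imsetP[t tS ->]; exact: switching_target.
have cardE (A : {set sgraph V}) (F : sgraph V -> {set V * V}) :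
    #|[set t : sgraph V * (V * V) | (t.1 \in A) && (t.2 \in F t.1)]%SET| =
    (\sum_(G in A) #|F G|)%N.
  rewrite -sum1_card; under [RHS]eq_bigr do rewrite -sum1_card.
  by rewrite pair_big_dep /=; apply: eq_bigl => -[G p]; rewrite inE.
rewrite !cardE.
have -> : (\sum_(G in light_ball_graphs k v) #|light_darts G| =
    #|light_ball_graphs k v| * L)%N.
  rewrite -sum_nat_const; apply: eq_bigr => G; rewrite inE => /andP[dG _].
  exact: card_light_darts.
have : (#|light_ball_graphs k.+2 v| * (s - 2 * L) <=
    \sum_(G in light_ball_graphs k.+2 v) #|heavy_darts G|)%N.
  rewrite -sum_nat_const; apply: leq_sum => G; rewrite inE => /andP[dG _].
  by rewrite leq_subLR addnC card_heavy_darts.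
move=> /leq_trans H /H {H}.
move: #|_| #|_| => a b H.
(* From [8 * L <= s], the factor [s - 2 * L] is at least [6 * L]. *)
have H6 : (b * (6 * L) <= a * L)%N.
  by apply: leq_trans H; rewrite leq_mul2l; apply/orP; right; lia.
(* If [L] is 0 it cannot be cancelled, but then [b * s <= 0] forces [b = 0]. *)
have [L0|L0] := posnP L; last by rewrite -(leq_pmul2r L0) -mulnA mulnCA.
by move: H; rewrite L0 muln0 subn0; case: b {H6} => // b; rewrite mulSn; lia.
Qed.

End LightBalls.
End Switching.

(** * From the whole graph to its components *)

Section Components.
Variables (V : finType) (G : sgraph V) (C : {set V}).
Hypothesis C_comp : C \in components G.
Let H := induced_subgraph G C.

Lemma adj_induced (x y : {x : V | x \in C}) :
  adj H x y = adj G (val x) (val y).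
Proof. by rewrite /adj inE imsetU1 imset_set1. Qed.

Lemma deg_induced (x : {x : V | x \in C}) : deg H x = deg G (val x).
Proof.
rewrite /deg -(card_imset _ val_inj); apply: eq_card => y.
rewrite inE; apply/imsetP/idP => [[z]|xy].
  by rewrite inE adj_induced => xz ->.
have yC : y \in C by rewrite (in_components _ C_comp (valP x)) connect1.
by exists (Sub y yC) => //; rewrite inE adj_induced.
Qed.

Lemma sum_deg_induced : (\sum_x deg H x <= \sum_v deg G v)%N.
Proof.
under eq_bigr do rewrite deg_induced.
rewrite -(big_imset (deg G) (in2W val_inj)) /=.
by rewrite [leqRHS](bigID (mem [set val x | x : {x : V | x \in C}]%SET)) leq_addr.
Qed.

Lemma gball_induced (k : nat) (x y : {x : V | x \in C}) :
  val y \in gball G k (val x) -> y \in gball H k x.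
Proof.
elim: k y => [|k IH] y; first by rewrite !inE.
case/gballSP => [/IH|[z zB zy]]; first by apply: gball_mono.
have zC : z \in C by rewrite (in_components _ C_comp (valP x)) (gball_connect zB).
by apply: (@gball_step _ _ _ _ (Sub z zC)); rewrite ?IH // adj_induced.
Qed.

End Components.

Lemma component_mixing_time_le (R : realType) (V : finType) (G : sgraph V)
    (r : nat) (C : {set V}) :
  (forall v, (0 < deg G v)%N) ->
  (forall v : V,
    (exists2 h, h \in gball G r v & (\sum_u deg G u <= 8 * #|V| * deg G h)%N) \/
    (forall z, connect (adj G) v z -> z \in gball G r v)) ->
  C \in components G ->
  (mixing_time R (induced_subgraph G C) <=
   ((576 * #|V| ^ 2 * (2 * r + 3)).+1%:R)%:E)%E.
Proof.
move=> dG near CG; set s := (\sum_u deg G u)%N in near *.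
have [x xC] : exists x, x \in C.
  by case/imsetP: CG => x _ ->; exists x; rewrite !inE connect0.
have s0 : (0 < s)%N by rewrite /s (bigD1 x) //= ltn_addr.
(* The value of [diameter_bound] for [a = s] and [b = 8 * #|V|]. *)
set L := (((8 * #|V| * #|V|) %/ s).+1 * (2 * r + 3))%N.
apply: (@le_trans _ _ ((64 * (\sum_v deg (induced_subgraph G C) v) * L).+1%:R)%:E).
  apply: mixing_time_le => [v||y z]; first by rewrite deg_induced.
    by rewrite /L muln_gt0 /= addn_gt0 orbT.
  apply: gball_induced => //; apply: diameter_bound => //.
  by rewrite -(in_components _ CG (valP y)) (valP z).
rewrite lee_fin ler_nat ltnS.
apply: (@leq_trans (64 * (s * L))).
  by rewrite -mulnA leq_mul2l /= leq_mul2r sum_deg_induced ?orbT.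
have sV : (s <= #|V| ^ 2)%N.
  rewrite expnS expn1 -sum_nat_const; apply: leq_sum => v _; exact: max_card.
have : (s * ((8 * #|V| * #|V|) %/ s) <= 8 * #|V| * #|V|)%N by rewrite mulnC leq_divM.
rewrite /L; move: (_ %/ s)%N => c; move: (2 * r + 3)%N => q.
rewrite expnS expn1 in sV *; move: sV; move: #|V| => n sV cs.
(* The 9 comes from [s * c.+1 <= 8 * n^2 + s] and [s <= n^2]. *)
have -> : (576 * (n * n) * q = 64 * ((9 * (n * n)) * q))%N by rewrite !mulnA.
rewrite leq_mul2l /= mulnA leq_mul2r; apply/orP; right.
by rewrite mulnS; lia.
Qed.

(** * Exceptional graphs are rare, and all others mix fast *)

Section Exceptional.
Variables (V : finType) (d : V -> nat).
Hypothesis d_gt0 : forall v, (0 < d v)%N.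

Definition light (v : V) : bool := (8 * #|V| * d v < \sum_u d u)%N.

Lemma sum_light_le : (8 * \sum_(u | light u) d u <= \sum_u d u)%N.
Proof.
have [V0|V0] := posnP #|V|.
  rewrite big1 ?muln0 // => v _; by case: (fintype0 v V0).
rewrite -(leq_pmul2l V0) mulnA [(#|V| * 8)%N]mulnC big_distrr /=.
rewrite -sum_nat_const [leqLHS]big_mkcond /=; apply: leq_sum => v _.
by case: ifP => // /ltnW.
Qed.

Lemma light_ball_graphs_decay (j : nat) (v : V) :
  (6 ^ j * #|light_ball_graphs d light (2 * j) v| <= #|with_degrees d|)%N.
Proof.
elim: j => [|j IH].
  by rewrite mul1n; apply: subset_leq_card; apply/fintype.subsetP => G; rewrite inE => /andP[].
apply: leq_trans IH; rewrite expnSr -mulnA leq_mul2l; apply/orP; right.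
rewrite mulnS; apply: light_ball_graphs_step; first exact: sum_light_le.
by rewrite (bigD1 v) //= ltn_addr.
Qed.

(** Union bound over the centre of the light ball. *)
Lemma exceptional_graphs_le (j : nat) :
  (6 ^ j * #|[set G in with_degrees d | [exists v, light_ball light G (2 * j) v]]%SET|
    <= #|V| * #|with_degrees d|)%N.
Proof.
apply: (@leq_trans (6 ^ j * \sum_v #|light_ball_graphs d light (2 * j) v|)).
  rewrite leq_mul2l; apply/orP; right.
  rewrite -sum1_card big_mkcond /=.
  under [leqRHS]eq_bigr do rewrite -sum1_card big_mkcond /=.
  rewrite exchange_big /=; apply: leq_sum => G _; case: ifP => //.
  rewrite inE => /andP[dG /existsP[v lG]].
  by rewrite (bigD1 v) //= inE dG lG.
rewrite big_distrr /= -sum_nat_const; apply: leq_sum => v _.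
exact: light_ball_graphs_decay.
Qed.

Lemma typical_mixing_time_le (R : realType) (j : nat) (G : sgraph V) (C : {set V}) :
  G \in with_degrees d -> ~~ [exists v, light_ball light G (2 * j) v] ->
  C \in components G ->
  (mixing_time R (induced_subgraph G C) <=
   ((576 * #|V| ^ 2 * (4 * j + 3)).+1%:R)%:E)%E.
Proof.
rewrite inE => /forallP dG /existsPn good CG.
have dE v : deg G v = d v by apply/eqP.
have := @component_mixing_time_le R V G (2 * j) C; rewrite (mulnA 2 2).
apply=> // v; first by rewrite dE.
(* A ball fails to be a light ball by containing a heavy vertex or by having no exit. *)
have := good v; rewrite negb_and => /orP[/forall_inPn[u uB lu]|/existsPn noexit].
  left; exists u => //; move: lu; rewrite /light -leqNgt dE.
  by under eq_bigr do rewrite -dE.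
by right=> z; apply: gball_closed => p q; have := noexit (p, q).
Qed.

End Exceptional.

(** * Probability estimate and asymptotics *)

Lemma size_le_sumn (s : seq nat) : (0 \notin s)%N -> (size s <= sumn s)%N.
Proof.
elim: s => [//|x s IH] /=; rewrite inE negb_or eq_sym -lt0n => /andP[x0 /IH].
by rewrite -add1n => /(leq_add x0).
Qed.

Lemma prob_le1 (R : realType) (D : seq nat) (A : pred (sgraph 'I_(size D))) :
  prob R A <= 1.
Proof.
rewrite /prob; have [->|R0] := posnP #|realizations D|; first by rewrite invr0 mulr0.
rewrite ler_pdivrMr ?ltr0n // mul1r ler_nat; apply: subset_leq_card.
by apply/fintype.subsetP => G; rewrite inE => /andP[].
Qed.

Lemma prob_small_mixing_time (R : realType) (D : seq nat) (j : nat) (t : \bar R) :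
  feasible D -> (0 \notin D)%N -> (0 < size D)%N -> (size D <= 2 ^ j)%N ->
  (((576 * size D ^ 2 * (4 * j + 3)).+1%:R)%:E <= t)%E ->
  1 - (size D)%:R^-1 <= prob R (fun G : sgraph 'I_(size D) =>
    [forall C in components G, (mixing_time R (induced_subgraph G C) <= t)%E]).
Proof.
move=> [_ [G0 G0D]] D0 n0 nj le_t; set n := size D in n0 nj le_t *.
pose d (i : 'I_n) := nth 0%N D i.
have d0 i : (0 < d i)%N.
  by rewrite lt0n; apply: contraNneq D0 => <-; apply: mem_nth.
set A := fun G => _; pose bad G := [exists v, light_ball (light d) G (2 * j) v].
have R0 : (0 < #|realizations D|)%N by apply/card_gt0P; exists G0.
have badA : (#|realizations D| <= #|[set G in realizations D | A G]%SET| +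
    #|[set G in with_degrees d | bad G]%SET|)%N.
  rewrite -cardsUI; apply: leq_trans (leq_addr _ _).
  apply: subset_leq_card; apply/fintype.subsetP => G GD; rewrite !inE.
  rewrite inE in GD; rewrite GD /=; case: (boolP (bad G)) => [_|good].
    by rewrite orbT.
  rewrite orbF; apply/forall_inP => C CG; apply: le_trans le_t.
  have := @typical_mixing_time_le _ d d0 R j G C; rewrite card_ord.
  by apply=> //; rewrite inE.
(* The union bound n / 6^j is at most 1 / n because n^2 <= 4^j <= 6^j. *)
have bad_small : (n * #|[set G in with_degrees d | bad G]%SET| <= #|realizations D|)%N.
  rewrite -(leq_pmul2l n0); apply: leq_trans (_ : n * #|with_degrees d| <= _)%N => //.
  have := exceptional_graphs_le d0 j; rewrite card_ord; apply: leq_trans.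
  rewrite mulnA leq_mul2r; apply/orP; right.
  apply: (leq_trans (leq_mul nj nj)); rewrite -expnMn.
  by case: (j) => // ?; rewrite leq_exp2r.
rewrite /prob ler_pdivlMr ?ltr0n //.
have n0' : 0 < n%:R :> R by rewrite ltr0n.
rewrite -(ler_pM2l n0') mulrA mulrBr mulr1 divff ?gt_eqF //.
rewrite -(ler_nat R) natrD -(ler_pM2l n0') mulrDr in badA.
rewrite -(ler_nat R) natrM in bad_small.
by rewrite mulrBl mul1r; lra.
Qed.

(** With j = [up_log 2 n], 2^(j-1) < n and 2 <= n give 2^j <= n^2. *)
Lemma up_log_ln (R : realType) (n : nat) : (1 < n)%N ->
  (up_log 2 n)%:R * ln 2 <= 2 * ln n%:R :> R.
Proof.
move=> n1; have n0 : 0 < n%:R :> R by rewrite ltr0n ltnW.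
have : (2 ^ up_log 2 n <= n * n)%N.
  have := up_log_gtn (isT : 1 < 2)%N n1; have := up_log_gt0 2 n; rewrite n1 /=.
  case: (up_log 2 n) => // j _ /= /ltnW jn.
  by rewrite expnS leq_mul.
rewrite -(ler_nat R) natrX natrM => H.
have : ln (2 ^+ up_log 2 n) <= ln (n%:R * n%:R) :> R.
  by rewrite ler_ln ?posrE ?exprn_gt0 ?mulr_gt0.
by rewrite lnXn // lnM ?posrE // -mulr_natl; lra.
Qed.

(** Here 6337 = 576 * (4 * 2 + 3) + 1, where j ln 2 <= 2 ln n gives the 2 and ln 2 <= ln n absorbs
    the lower terms. *)
Lemma scale_le (R : realType) (n j : nat) (x : R) : (1 < n)%N -> 1 <= x ->
  j%:R * ln 2 <= 2 * ln n%:R :> R ->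
  (576 * n ^ 2 * (4 * j + 3)).+1%:R <= 6337 / ln 2 * (n%:R ^+ 2 * x * ln n%:R).
Proof.
move=> n1 x1 jn; have n0 : 0 < n%:R :> R by rewrite ltr0n ltnW.
have ln2 : 0 < ln 2 :> R by rewrite ln_gt0 // ltr1n.
have lnn : ln 2 <= ln n%:R :> R by rewrite ler_ln ?posrE // ler_nat.
have y1 : 1 <= n%:R ^+ 2 :> R by rewrite exprn_ege1 // ler1n ltnW.
have -> : (576 * n ^ 2 * (4 * j + 3)).+1%:R = 576 * n%:R ^+ 2 * (4 * j%:R + 3) + 1 :> R.
  by rewrite -natr1 natrM natrD (natrM _ 4) (natrM _ 576) natrX.
move: (n%:R ^+ 2) (ln n%:R) (ln 2) (j%:R : R) y1 lnn ln2 jn => y b a z y1 ab a0 zb.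
have yb0 : 0 <= y * b by rewrite mulr_ge0; lra.
apply: (@le_trans _ _ (6337 / a * (y * b))); last first.
  apply: ler_wpM2l; first by apply: divr_ge0; lra.
  by rewrite mulrAC ler_peMr.
rewrite [leRHS]mulrAC ler_pdivlMr //.
have h1 : y * (z * a) <= y * (2 * b) by apply: ler_wpM2l => //; lra.
have h2 : y * a <= y * b by apply: ler_wpM2l => //; lra.
have h3 : a <= y * a by rewrite ler_peMl // ltW.
rewrite mulrDl mul1r.
have -> : 576 * y * (4 * z + 3) * a = 576 * (4 * (y * (z * a)) + 3 * (y * a)) by ring.
lra.
Qed.

Theorem corollary1p4 (R : realType) (h : nat -> R) (D : nat -> seq nat)
  (h_infty : (h k @[k --> \oo] --> +oo)%classic)
  (D_feasible : forall l, feasible (D l))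
  (n_infty : (size (D l) @[l --> \oo] --> \oo)%classic)
  (no_deg0 : forall l, count_mem 0%N (D l) = 0%N)
  (D_giant : has_giant_component R D) :
  exists K : R,
    whp R D (fun l G =>
      [forall C in components G,
        (mixing_time R (induced_subgraph G C) <=
         (K * ((size (D l))%:R ^+ 2 * h (num_edges (D l))
               * ln (size (D l))%:R))%:E)%E]).
Proof.
have num0 l : (0 \notin D l)%N.
  by apply: contraT; rewrite negbK -has_pred1 has_count no_deg0.
have n_ge N : (\forall l \near \oo, (N <= size (D l))%N)%classic.
  by move: n_infty => /cvgnyPge.
exists (6337 / ln 2); apply/cvgrPdist_le => e e0.
have /cvgryPge/(_ 1) [K0 _ h1] := h_infty.
near=> l.
(* All degrees are positive, so the degree sum is at least n, and [2 * K0 <= n] puts the number of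
   edges in the range where [h] is at least 1. *)
have nN : (maxn 2 (2 * K0) <= size (D l))%N by near: l; exact: n_ge.
have ne : (Num.bound e^-1 <= size (D l))%N by near: l; exact: n_ge.
move: nN; rewrite geq_max => /andP[n2 nK]; set n := size (D l) in n2 nK ne *.
have n0 : 0 < n%:R :> R by rewrite ltr0n (leq_trans _ n2).
have ninv : n%:R^-1 <= e.
  rewrite -[e]invrK lef_pV2 ?posrE ?invr_gt0 //.
  apply: (le_trans (ltW (archi_boundP _))); first by rewrite invr_ge0 ltW.
  by rewrite ler_nat.
rewrite ger0_norm ?subr_ge0 ?prob_le1 //.
rewrite lerBlDr -lerBlDl; apply: le_trans (_ : 1 - n%:R^-1 <= _).
  by rewrite lerB.
apply: (@prob_small_mixing_time _ _ (up_log 2 n)) => //.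
- by rewrite (leq_trans _ n2).
- exact: up_logP.
have hm : 1 <= h (num_edges (D l)).
  apply: h1 => /=; rewrite /num_edges; have := size_le_sumn (num0 l).
  by move: nK; rewrite /n; lia.
by rewrite lee_fin scale_le // up_log_ln.
Unshelve. all: by end_near.
Qed.
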